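(* Let $G$ be a median graph with basepoint $v_0$, let $u,v\in V$ with $u\in I(v_0,v)$, let $L$ be a POF outgoing from $v$, and let $w$ be the anti-basis of the hypercube with basis $v$ and signature $L$. The following are equivalent: (i) $\overline{\pi}(u,w)=v$; (ii) $\Pi(u,w)=\Pi(u,v)\cup\{w\}$; (iii) for every class $E_i\in L$, the set $\overline{L}_{u,v}\cup\{E_i\}$ is not a POF.
   Context: $G=(V,E)$ is a finite, connected, undirected median graph (every triple $x,y,z$ has exactly one vertex in $I(x,y)\cap I(y,z)\cap I(z,x)$, with $I(x,y)=\{w: d(x,w)+d(w,y)=d(x,y)\}$). $\Theta$-classes are the classes of the reflexive transitive closure of the relation ''$xy$ and $x'y'$ are opposite edges of a 4-cycle''; each class splits $G$ into two halfspaces. Classes $E_i,E_j$ are orthogonal if some 4-cycle $abcd$ has $ab,cd\in E_i$ and $bc,da\in E_j$; a POF is a set of pairwise orthogonal classes. Edges are oriented away from the fixed basepoint $v_0$; a POF $L$ is outgoing from $x$ if each class of $L$ has an edge oriented out of $x$, and then the hypercube with basis $x$ and signature $L$ is the unique induced hypercube whose vertex closest to $v_0$ (basis) is $x$ and whose edges have exactly the classes of $L$; its anti-basis is its vertex farthest from $v_0$. For $x\in I(v_0,y)$, the ladder set $L_{x,y}$ is the set of classes separating $x$ and $y$ that have an edge incident to $x$ (it is a POF outgoing from $x$). Milestones: for $x\in I(v_0,y)$, let $x^+$ be the anti-basis of the hypercube with basis $x$ and signature $L_{x,y}$; if $x^+=y$ then $\Pi(x,y)=\{x,y\}$, otherwise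 $\Pi(x,y)=\{x\}\cup\Pi(x^+,y)$. The penultimate milestone $\overline{\pi}(x,y)$ is the milestone in $\Pi(x,y)$ other than $y$ that is closest to $y$, and $\overline{L}_{x,y}$ is the set of $\Theta$-classes of the hypercube with basis $\overline{\pi}(x,y)$ and anti-basis $y$.
   Formalization: The equivalence of (i) and (ii) is stated for L nonempty (for L empty, w = v, so (i) fails while (ii) holds), and the equivalence of (ii) and (iii) for u different from v (for u = v the set of classes L-bar_{u,v} is undefined). *)

(* Defs.v *)
From mathcomp Require Import all_boot.

Set Implicit Arguments.
Unset Strict Implicit.
Unset Printing Implicit Defensive.

Section MedianGraph.

Variables (V : finType) (e : rel V).

(* Length of a shortest walk; it is [#|V|] when [y] is unreachable from [x]. *)
Definition dist (x y : V) : nat :=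
  find (fun n => [exists p : n.-tuple V, path e x p && (last x p == y)])
       (iota 0 #|V|).

Definition interval (x y : V) : {set V} :=
  [set w | dist x w + dist w y == dist x y].

Definition median_graph : Prop :=
  [/\ symmetric e, irreflexive e, (forall x y, connect e x y)
    & forall x y z,
        #|interval x y :&: interval y z :&: interval z x| = 1].

(* An undirected edge is represented by the pair [set x; y] of its ends. *)
Definition edges : {set {set V}} :=
  [set a | [exists x, exists y, e x y && (a == [set x; y])]].

Definition four_cycle (a b c d : V) : bool :=
  [&& e a b, e b c, e c d, e d a, a != c & b != d].

Definition opposite (f g : {set V}) : bool :=
  [exists a, exists b, exists c, exists d,
    [&& four_cycle a b c d, f == [set a; b] & g == [set c; d]]].

Definition theta_classes : {set {set {set V}}} :=
  equivalence_partition (connect opposite) edges.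

(* The halfspaces of [E] are the connected components of the graph with the   *)
(* edges of [E] removed.                                                      *)
Definition separates (E : {set {set V}}) (x y : V) : bool :=
  ~~ connect [rel a b | e a b && ([set a; b] \notin E)] x y.

Definition orthogonal (E F : {set {set V}}) : bool :=
  [exists a, exists b, exists c, exists d,
    [&& four_cycle a b c d, [set a; b] \in E, [set c; d] \in E,
        [set b; c] \in F & [set d; a] \in F]].

Definition POF (L : {set {set {set V}}}) : bool :=
  (L \subset theta_classes) &&
  [forall E in L, forall F in L, (E != F) ==> orthogonal E F].

(* [Q] induces a [k]-cube for some [k]; the bound [k < #|V|] is harmless      *)
(* since [2 ^ k = #|Q| <= #|V|].                                              *)
Definition is_hypercube (Q : {set V}) : bool :=
  [exists k : 'I_#|V|, exists f : {ffun {ffun 'I_k -> bool} -> V},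
    [&& injectiveb f, Q == [set f s | s in [set: {ffun 'I_k -> bool}]]
      & [forall s : {ffun 'I_k -> bool}, forall t : {ffun 'I_k -> bool},
          e (f s) (f t) == (#|[set i | s i != t i]| == 1)]]].

Definition signature (Q : {set V}) : {set {set {set V}}} :=
  [set E in theta_classes | [exists a in E, a \subset Q]].

Variable v0 : V.

Definition outgoing (x : V) (L : {set {set {set V}}}) : bool :=
  [forall E in L, exists y, ([set x; y] \in E) && (dist v0 x < dist v0 y)].

Definition is_basis (Q : {set V}) (x : V) : bool :=
  (x \in Q) && [forall z in Q, dist v0 x <= dist v0 z].

Definition is_antibasis (Q : {set V}) (x : V) : bool :=
  (x \in Q) && [forall z in Q, dist v0 z <= dist v0 x].

(* When [L] is a POF outgoing from [x] in a median graph, exactly one [Q]     *)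
(* satisfies the condition below; otherwise the value may be junk.            *)
Definition hypercube_sig (x : V) (L : {set {set {set V}}}) : {set V} :=
  odflt set0 [pick Q : {set V} |
    [&& is_hypercube Q, is_basis Q x & signature Q == L]].

Definition antibasis (x : V) (L : {set {set {set V}}}) : V :=
  odflt x [pick w | is_antibasis (hypercube_sig x L) w].

Definition hypercube_between (x y : V) : {set V} :=
  odflt set0 [pick Q : {set V} |
    [&& is_hypercube Q, is_basis Q x & is_antibasis Q y]].

Definition ladder (x y : V) : {set {set {set V}}} :=
  [set E in theta_classes | separates E x y & [exists z, [set x; z] \in E]].

Definition next_milestone (x y : V) : V := antibasis x (ladder x y).

(* [next_milestone x y] lies in [interval x y] and differs from [x] when      *)
(* [x != y], so the distance to [y], which is less than [#|V|], decreases     *)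
(* along the recursion and the fuel [#|V|] is never exhausted.                *)
Fixpoint milestones_rec (n : nat) (x y : V) : {set V} :=
  if n is n'.+1 then
    let x' := next_milestone x y in
    if x' == y then [set x; y] else x |: milestones_rec n' x' y
  else [set x; y].

Definition milestones (x y : V) : {set V} := milestones_rec #|V| x y.

(* Meaningful for [x != y] only, in which case [x] is a milestone other than  *)
(* [y]; for [x = y] the value is [x].                                         *)
Definition penultimate (x y : V) : V :=
  [arg min_(p < x in milestones x y :\ y) dist p y].

Definition penultimate_classes (x y : V) : {set {set {set V}}} :=
  signature (hypercube_between (penultimate x y) y).

End MedianGraph.

(* Main.v *)
(** Let [sep x y] be the set of Theta-classes separating [x] and [y].  It is
additive modulo symmetric difference, [dist x y = #|sep x y|], and the median
of [x], [y], [z] satisfies [sep x m = sep x y :&: sep x z]; so [x |-> sep v0 x]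
is an isometric embedding into a hypercube that turns medians into majorities.
A POF [L] all of whose classes are incident to [x] spans the cube
[{y | sep x y \subset L}], and every hypercube has this form.

Write [p] for the penultimate milestone of [(u, v)], so that the penultimate
classes are [sep p v = ladder p v].  If [E \in L] is incident to a milestone
[x] of [(u, v)], then, being also incident to [v] and separating neither, it is
incident to every vertex between them, in particular to [p]; hence
[sep p v :|: [set E]] lies in the POF [ladder p w].  If no such POF exists,
[ladder x w = ladder x v] along all milestones before [v], and the milestones
of [(u, w)] are those of [(u, v)] followed by [w].  Conversely, a POF
[sep p v :|: [set E]] spans a cube at [v], which makes [E] incident to [p];
the milestone following [p] towards [w] then lies across [E], and [v] is
skipped. *)

Require Import Defs.
From mathcomp Require Import all_boot zify.

Set Implicit Arguments.
Unset Strict Implicit.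
Unset Printing Implicit Defensive.

(** * Graph distance *)

Section Distance.

Variables (V : finType) (e : rel V).
Hypothesis econn : forall x y, connect e x y.

Local Notation d := (dist e).

Definition walk (n : nat) (x y : V) : bool :=
  [exists p : n.-tuple V, path e x p && (last x p == y)].

Lemma walkP n x y :
  reflect (exists p, [/\ size p = n, path e x p & last x p = y]) (walk n x y).
Proof.
apply: (iffP existsP) => [[p /andP[ep /eqP lp]]|[p [sp ep lp]]].
  by exists p; rewrite size_tuple.
have sp' : size p == n by apply/eqP.
by exists (Tuple sp'); rewrite /= ep lp eqxx.
Qed.

(** Connectivity gives a path, which shortens to a duplicate-free one with fewer than [#|V|] edges;
    so the search in [dist] succeeds and its default value never occurs. *)
Lemma dist_walk_lt x y : walk (d x y) x y /\ d x y < #|V|.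
Proof.
have [p ep ->] := connectP (econn x y).
have [q eq uq _] := shortenP ep.
have sq : size q < #|V| by have := max_card (mem (x :: q));
  rewrite (card_uniqP uq).
have wq : walk (size q) x (last x q) by apply/walkP; exists q.
have hq : has (fun n => walk n x (last x q)) (iota 0 #|V|).
  by apply/hasP; exists (size q); rewrite // mem_iota.
have := hq; rewrite has_find size_iota => lt_d; split=> //.
by have := nth_find 0 hq; rewrite nth_iota // add0n.
Qed.

Lemma dist_lt_card x y : d x y < #|V|.
Proof. by case: (dist_walk_lt x y). Qed.

Lemma dist_leq_size x p : path e x p -> d x (last x p) <= size p.
Proof.
move=> ep; have wp : walk (size p) x (last x p) by apply/walkP; exists p.
rewrite leqNgt; apply/negP => lt_p.
have := before_find 0 lt_p; rewrite nth_iota.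
  by rewrite add0n; move: wp; rewrite /walk => ->.
exact: ltn_trans lt_p (dist_lt_card _ _).
Qed.

Lemma dist_geodesic x y : exists p, [/\ size p = d x y, path e x p & last x p =
  y].
Proof. by apply/walkP; case: (dist_walk_lt x y). Qed.

Lemma dist_triangle y x z : d x z <= d x y + d y z.
Proof.
have [p [<- ep <-]] := dist_geodesic x y.
have [q [<- eq <-]] := dist_geodesic (last x p) z.
by rewrite -size_cat -last_cat dist_leq_size // cat_path ep.
Qed.

Lemma distxx x : d x x = 0.
Proof. by apply/eqP; rewrite -leqn0 (@dist_leq_size x [::]). Qed.

Lemma dist_eq0 x y : (d x y == 0) = (x == y).
Proof.
apply/eqP/eqP => [d0|->]; last exact: distxx.
by have [[|z p] [sp _ <-]] := dist_geodesic x y; rewrite // d0 in sp.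
Qed.

Lemma dist_edge x y : e x y -> d x y <= 1.
Proof. by move=> exy; have /= -> := @dist_leq_size x [:: y];
  rewrite //= exy. Qed.

Lemma edge_of_dist1 x y : d x y = 1 -> e x y.
Proof.
move=> d1; have [[|z [|z' p]] [sp ep <-]] := dist_geodesic x y;
  rewrite d1 // in sp.
by case/andP: ep.
Qed.

Lemma dist_step n x y : d x y = n.+1 -> exists2 z, e x z & d z y = n.
Proof.
move=> dn; have [[|z p] [sp /= ep lp]] := dist_geodesic x y;
  rewrite dn // in sp.
case/andP: ep => exz ep; exists z => //; apply/eqP; rewrite eqn_leq.
have := dist_leq_size ep; rewrite lp; case: sp => -> -> /=.
by have := dist_triangle z x y; have := dist_edge exz; lia.
Qed.

Hypothesis eC : symmetric e.

Lemma distC x y : d x y = d y x.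
Proof.
wlog suff: x y / d x y <= d y x by move=> H; apply/eqP; rewrite eqn_leq !H.
have [p [<- ep <-]] := dist_geodesic y x.
have := @dist_leq_size (last y p) (rev (belast y p)).
rewrite rev_path (eq_path (e' := e)); last by move=> a b; rewrite /= eC.
rewrite size_rev size_belast => /(_ ep).
by case: p {ep} => [|z p] //=; rewrite ?distxx // rev_cons last_rcons.
Qed.

End Distance.

(** * Halfspaces and the classes separating two vertices *)

Section Median.

Variables (V : finType) (e : rel V).
Hypothesis Gmed : median_graph e.

Local Notation d := (dist e).

Let eC : symmetric e. Proof. by case: Gmed. Qed.
Let eirr : irreflexive e. Proof. by case: Gmed. Qed.
Let econn x y : connect e x y. Proof. by case: Gmed. Qed.
Let dC x y : d x y = d y x. Proof. exact: distC. Qed.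
Let dtri y x z : d x z <= d x y + d y z. Proof. exact: dist_triangle. Qed.

Lemma dist1 x y : (d x y == 1) = e x y.
Proof.
apply/eqP/idP => [/(edge_of_dist1 econn)//|exy].
apply/eqP; rewrite eqn_leq dist_edge // lt0n dist_eq0 //.
by apply: contraTneq exy => ->; rewrite eirr.
Qed.

Lemma median_ex x y z : exists m,
  [/\ d x m + d m y = d x y, d y m + d m z = d y z & d z m + d m x = d z x].
Proof.
case: Gmed => _ _ _ /(_ x y z) /eqP/cards1P[m Em].
exists m; have: m \in [set m] by rewrite set11.
by rewrite -Em !inE => /andP[/andP[/eqP-> /eqP->] /eqP->].
Qed.

Lemma median_uniq x y z m m' :
  d x m + d m y = d x y -> d y m + d m z = d y z -> d z m + d m x = d z x ->
  d x m' + d m' y = d x y -> d y m' + d m' z = d y z ->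
  d z m' + d m' x = d z x -> m = m'.
Proof.
move=> h1 h2 h3 k1 k2 k3.
case: Gmed => _ _ _ /(_ x y z) /eqP/cards1P[a Ea].
have: m \in [set a] by rewrite -Ea !inE h1 h2 h3 !eqxx.
have: m' \in [set a] by rewrite -Ea !inE k1 k2 k3 !eqxx.
by move=> /set1P-> /set1P->.
Qed.

(** The median of [x], [y], [z] lies on the edge [xy], hence is one of its ends, and the other end
    is one step farther from [z]. This is bipartiteness. *)
Lemma edge_dist_neq x y z : e x y -> d x z != d y z.
Proof.
rewrite -dist1 => /eqP dxy; apply/eqP => dz.
have [m [h1 h2 h3]] := median_ex x y z.
have := dC x m; have := dC y m; have := dC z m; have := dC z x.
have [/eqP|] := eqVneq (d x m) 0; first by rewrite dist_eq0 // => /eqP Em;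
  subst m; lia.
have [/eqP|] := eqVneq (d m y) 0; first by rewrite dist_eq0 // => /eqP Em;
  subst m; lia.
by lia.
Qed.

Lemma edge_dist x y z : e x y -> d x z = (d y z).+1 \/ d y z = (d x z).+1.
Proof.
move=> exy; have := edge_dist_neq z exy; have := dtri y x z; have := dtri x y z.
by have := exy; rewrite -dist1 (dC y x) => /eqP->; lia.
Qed.

(** An edge [yz] would have both ends equidistant from [t], so [y] and [z] are at distance 2; the
    median of [y], [z], [t] is the required vertex. *)
Lemma quadrangle x y z t : e x y -> e x z -> y != z ->
  d x t = (d y t).+1 -> d x t = (d z t).+1 ->
  exists q, [/\ e y q, e z q & d y t = (d q t).+1].
Proof.
move=> exy exz nyz dy dz.
have dyz : d y z = 2.
  have nz0 : d y z != 0 by rewrite dist_eq0.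
  have : d y z != 1.
    by rewrite dist1; apply: contraTN isT => eyz; have := edge_dist_neq t eyz;
      lia.
  have := dtri x y z; have := dist_edge econn exy; have := dist_edge econn exz.
  by rewrite (dC y x); lia.
have [q [h1 h2 h3]] := median_ex y z t.
have := dC y q; have := dC z q; have := dC t q; have := dC t y.
move=> e1 e2 e3 e4.
by exists q; split; [rewrite -dist1; lia | rewrite -dist1; lia | lia].
Qed.

(** The halfspace of the edge [ab] on the side of [a], described by distances alone. *)
Definition nearer (a b x : V) : bool := d x a < d x b.

Lemma nearerC a b x : e a b -> nearer b a x = ~~ nearer a b x.
Proof. by move=> /(edge_dist x); rewrite /nearer -!(dC x); lia. Qed.

(* Otherwise [b], [c'] and a third vertex [q] given by the quadrangle condition
   are three common neighbours of [a] and [c]; then both [a] and [c] are medians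
   of [b], [c'], [q]. *)
Lemma nearer_square_sub a b c c' x : four_cycle e a b c c' ->
  nearer a b x -> nearer c' c x.
Proof.
case/and5P => eab ebc ecc' ec'a /andP[nac nbc'] near_ab.
rewrite nearerC //; apply: contraTN isT => near_cc'.
have := edge_dist x eab; have := edge_dist x ebc; have := edge_dist x ecc'.
have := edge_dist x ec'a; move: near_ab near_cc';
  rewrite /nearer -!(dC x) => h1 h2 h3 h4 h5 h6.
have [|||q [eaq ecq dq]] := @quadrangle b a c x _ ebc nac;
  rewrite -?(dC x) 1?eC //; try lia.
have two y z : y != z -> e a y -> e a z -> d y z = 2.
  move=> nyz eay eaz.
  have := edge_dist y eaz; rewrite (dC z y) (dC a y).
  have := nyz; rewrite -(dist_eq0 econn).
  by move: eay; rewrite eC -dist1 => /eqP->; move: (d y z) => k; clear; lia.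
have nbq : b != q by apply: contraTneq isT => Eq; subst q;
  rewrite !(dC _ x) in dq; lia.
have nc'q : c' != q by apply: contraTneq isT => Eq; subst q;
  rewrite !(dC _ x) in dq; lia.
have eac' : e a c' by rewrite eC.
move: (eab) (eac') (eaq) (ebc) (ecc') (ecq).
rewrite (eC b c) -!dist1 => /eqP k1 /eqP k2 /eqP k3 /eqP k4 /eqP k5 /eqP k6.
suff Eac : a = c by rewrite Eac eqxx in nac.
by apply: (@median_uniq b c' q); rewrite ?(dC _ a) ?(dC _ c) ?k1 ?k2 ?k3 ?k4
  ?k5 ?k6 ?two // eq_sym.
Qed.

Lemma nearer_square a b c c' x : four_cycle e a b c c' ->
  nearer a b x = nearer c' c x.
Proof.
move=> sq; apply/idP/idP; first exact: nearer_square_sub sq.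
apply: nearer_square_sub; case/and5P: sq => eab ebc ecc' ec'a /andP[nac nbc'].
by apply/and5P; split; rewrite 1?eC // eq_sym nbc' eq_sym.
Qed.

(** An exclusive or, so that crossings add up modulo 2 along a walk. *)
Definition cut (a b x y : V) : bool := nearer a b x (+) nearer a b y.

Lemma cutC a b x y : cut a b x y = cut a b y x.
Proof. by rewrite /cut addbC. Qed.

Lemma cut_swap a b x y : e a b -> cut b a x y = cut a b x y.
Proof. by move=> eab; rewrite /cut !(nearerC _ eab) addNb addbN negbK. Qed.

Lemma cut_edge a b : e a b -> cut a b a b.
Proof.
by rewrite /cut /nearer !distxx // (dC b a) -dist1 => /eqP->.
Qed.

Lemma cut_edge_dist a b y : e a b -> cut a b a y = (d b y < d a y).
Proof.
move=> eab; rewrite /cut {1}/nearer distxx //.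
have := eab; rewrite -dist1 => /eqP->; rewrite addTb /nearer.
by have := edge_dist y eab; rewrite !(dC y); lia.
Qed.

(** [opposite] relates unordered pairs, so [cut] is transported to them; both orders of the ends
    give the same value. *)
Definition edge_cut (f : {set V}) (x y : V) : bool :=
  [exists a, exists b, [&& f == [set a; b], e a b & cut a b x y]].

Lemma set2_eqP (a b a' b' : V) : [set a; b] = [set a'; b'] ->
  (a = a' /\ b = b') \/ (a = b' /\ b = a').
Proof.
move=> E.
have : a \in [set a'; b'] by rewrite -E set21.
have : b \in [set a'; b'] by rewrite -E set22.
have : a' \in [set a; b] by rewrite E set21.
have : b' \in [set a; b] by rewrite E set22.
rewrite !inE => /orP[]/eqP h1 /orP[]/eqP h2 /orP[]/eqP h3 /orP[]/eqP h4;
  by [left; split; congruence | right; split; congruence].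
Qed.

Lemma edge_cutE a b x y : e a b -> edge_cut [set a; b] x y = cut a b x y.
Proof.
move=> eab; apply/existsP/idP => [[a' /existsP[b' /and3P[/eqP E ea'b' ct]]]|ct].
  by case: (set2_eqP E) => [[-> ->]|[-> ->]] //; rewrite cut_swap.
by exists a; apply/existsP; exists b; rewrite eqxx eab.
Qed.

Lemma opposite_edge_cut f g : opposite e f g ->
  edge_cut f =2 edge_cut g.
Proof.
move=> /existsP[a /existsP[b /existsP[c /existsP[c' /and3P[sq /eqP->
  /eqP->]]]]] x y.
have /and5P[eab _ ecc' _ _] := sq.
by rewrite !edge_cutE // -[RHS]cut_swap // /cut !(nearer_square _ sq).
Qed.

Lemma connect_edge_cut f g : connect (opposite e) f g ->
  edge_cut f =2 edge_cut g.
Proof.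
move=> /connectP[p pp ->] x y; elim: p f pp => //= h p IH f /andP[ofh /IH <-].
exact: opposite_edge_cut.
Qed.

Lemma opposite_sym : symmetric (opposite e).
Proof.
apply: symmetric_from_pre => f g.
move=> /existsP[a /existsP[b /existsP[c /existsP[c' /and3P[sq /eqP->
  /eqP->]]]]].
apply/existsP; exists c; apply/existsP; exists c'; apply/existsP; exists a;
  apply/existsP; exists b.
rewrite !eqxx !andbT; case/and5P: sq => eab ebc ecc' ec'a /andP[nac nbc'].
by apply/and5P; split=> //; rewrite eq_sym nac eq_sym.
Qed.

Lemma four_cycle_opposite a b c c' : four_cycle e a b c c' ->
  opposite e [set a; b] [set c; c'].
Proof.
move=> sq; apply/existsP; exists a; apply/existsP; exists b.
by apply/existsP; exists c; apply/existsP; exists c'; rewrite sq !eqxx.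
Qed.

(* The converse of [connect_edge_cut]: the edge [ab] is pushed towards [cc']
   through a ladder of 4-cycles. *)
Lemma nearer_connect a b c c' : e a b -> e c c' ->
  nearer a b c -> nearer b a c' -> connect (opposite e) [set a; b] [set c; c'].
Proof.
move=> + ecc'; move En : (d a c) => n; elim: n a b En => [|n IH] a b En eab
  near_c near_c'.
  move/eqP: En; rewrite dist_eq0 // => /eqP Ea; subst c.
  move: near_c'; rewrite /nearer (dC c' a); have := ecc';
    rewrite -dist1 => /eqP->.
  by rewrite ltnS leqn0 dist_eq0 // => /eqP->; rewrite connect0.
have [a' eaa' da'] := dist_step econn En.
have h1 := edge_dist c' eab; have h2 := edge_dist c eab;
  have h3 := edge_dist b ecc'.
have h4 := edge_dist a ecc'; have h5 := edge_dist c' eaa';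
  have h6 := edge_dist a' ecc'.
have c1 := dC c a; have c2 := dC c b; have c3 := dC c' a; have c4 := dC c' b.
have c5 := dC c a'; have c6 := dC c' a'.
move: near_c near_c'; rewrite /nearer => n1 n2.
have nba' : b != a' by apply: contraTneq isT => Ea; subst a'; lia.
have [||q [ebq ea'q dq]] := @quadrangle a b a' c' eab eaa' nba'; first by lia.
  by lia.
have naq : a != q by apply: contraTneq isT => Ea; subst q; lia.
have sq : four_cycle e a b q a' by apply/and5P; split; rewrite ?naq ?nba' // eC.
apply: (connect_trans (y := [set a'; q])).
  by apply: connect1; rewrite (setUC [set a']) four_cycle_opposite.
by apply: IH => //; rewrite -?(nearer_square _ sq) // nearerC //
  -(nearer_square _ sq) -nearerC.
Qed.

(** Turns the transitive closure behind Theta-classes into a condition on distances. *)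
Lemma connect_cut a b x y : e a b -> e x y ->
  connect (opposite e) [set a; b] [set x; y] = cut a b x y.
Proof.
move=> eab exy; apply/idP/idP => [/connect_edge_cut/(_ x y)|].
  by rewrite !edge_cutE // cut_edge.
rewrite /cut; case nx: (nearer a b x); case ny: (nearer a b y) => //= _.
  by apply: nearer_connect; rewrite // nearerC // ny.
by rewrite (setUC [set x]); apply: nearer_connect;
  rewrite ?[e y x]eC // nearerC // nx.
Qed.

(** * Theta-classes as cuts *)

Lemma edgesP f : reflect (exists x y, e x y /\ f = [set x; y]) (f \in edges e).
Proof.
rewrite inE; apply: (iffP existsP) => [[x /existsP[y /andP[exy /eqP->]]]|[x [y
  [exy ->]]]].
  by exists x, y.
by exists x; apply/existsP; exists y; rewrite exy eqxx.
Qed.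

Lemma mem_edges2 x y : ([set x; y] \in edges e) = e x y.
Proof.
apply/edgesP/idP => [[a [b [eab /set2_eqP[[-> ->]//|[-> ->]]]]]|exy];
  first by rewrite eC.
by exists x, y.
Qed.

Definition edge_class (a b : V) : {set {set V}} :=
  [set g in edges e | connect (opposite e) [set a; b] g].

Lemma theta_classesP E :
  reflect (exists a b, e a b /\ E = edge_class a b) (E \in theta_classes e).
Proof.
apply: (iffP imsetP) => [[f /edgesP[a [b [eab ->]]] ->]|[a [b [eab ->]]]].
  by exists a, b.
by exists [set a; b] => //; rewrite mem_edges2.
Qed.

Lemma mem_edge_class a b x y : e a b ->
  ([set x; y] \in edge_class a b) = e x y && cut a b x y.
Proof. by move=> eab; rewrite inE mem_edges2; case exy: (e x y) => //=;
  rewrite connect_cut. Qed.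

Lemma edge_class_id a b x y : e a b -> [set x; y] \in edge_class a b ->
  edge_class a b = edge_class x y.
Proof.
move=> eab; rewrite inE => /andP[_ con]; apply/setP => g; rewrite !inE;
  congr (_ && _).
by apply: same_connect => //; apply: sym_connect_sym opposite_sym.
Qed.

(** A walk avoiding the class never changes side, and a geodesic between two vertices of one side
    avoids the class; so the components are exactly the two sides of the edge [ab]. *)
Lemma separates_edge_class a b x y : e a b ->
  separates e (edge_class a b) x y = cut a b x y.
Proof.
move=> eab; rewrite /separates; set r := [rel _ _ | _].
have nr p q : r p q -> ~~ cut a b p q by rewrite /r /= mem_edge_class // =>
  /andP[->].
apply/idP/idP; last first.
  apply: contraTN => /connectP[p pp ->]; elim: p x pp => /= [|z p IH] x.
    by rewrite /cut addbb.
  case/andP=> /nr nxz /IH; move: nxz; rewrite /cut.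
  by case: (nearer a b x); case: (nearer a b z); case: (nearer a b _).
(* A geodesic that crosses the class at its first step cannot return. *)
apply: contraNT; move En: (d x y) => n; elim: n x En => [|n IH] x En nxy.
  by move/eqP: En; rewrite dist_eq0 // => /eqP->; apply: connect0.
have [z exz dz] := dist_step econn En.
have nxz : ~~ cut a b x z.
  apply: contra nxy => cxz.
  have : cut x z x y by rewrite cut_edge_dist //; lia.
  have con : connect (opposite e) [set a; b] [set x; z] by rewrite connect_cut.
  by rewrite -(edge_cutE _ _ exz) -(connect_edge_cut con) edge_cutE.
apply: (connect_trans (y := z)); first by apply: connect1;
  rewrite /r /= exz mem_edge_class // exz.
apply: IH => //; move: nxy nxz; rewrite /cut.
by case: (nearer a b x); case: (nearer a b z); case: (nearer a b y).
Qed.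

(** * Separating classes and the isometric embedding *)

Definition sep (x y : V) : {set {set {set V}}} :=
  [set E in theta_classes e | separates e E x y].

Lemma sepD y x z E : (E \in sep x z) = (E \in sep x y) (+) (E \in sep y z).
Proof.
rewrite !inE; case: theta_classesP => //= [[a [b [eab ->]]]].
rewrite !separates_edge_class // /cut.
by case: (nearer a b x); case: (nearer a b z); case: (nearer a b y).
Qed.

Lemma sepC x y : sep x y = sep y x.
Proof.
apply/setP => E; rewrite !inE; case: theta_classesP => //= [[a [b [eab ->]]]].
by rewrite !separates_edge_class // cutC.
Qed.

Lemma sep_theta x y E : E \in sep x y -> E \in theta_classes e.
Proof. by rewrite inE => /andP[]. Qed.

Lemma mem_theta E x y : E \in theta_classes e ->
  ([set x; y] \in E) = e x y && (E \in sep x y).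
Proof.
move=> ET; have /theta_classesP[a [b [eab EE]]] := ET.
by rewrite inE ET /= {}EE mem_edge_class // separates_edge_class.
Qed.

Lemma sep_edge x y : e x y -> exists E, sep x y = [set E].
Proof.
move=> exy; exists (edge_class x y); apply/setP => E; rewrite !inE.
apply/andP/eqP => [[/theta_classesP[a [b [eab ->]]]]|->].
  rewrite separates_edge_class // => ct; apply: edge_class_id => //.
  by rewrite mem_edge_class ?exy.
split; first by apply/theta_classesP; exists x, y.
by rewrite separates_edge_class // cut_edge.
Qed.

(** The first step [xz] of a geodesic to [y] crosses a single class, and this class does not
    separate [z] from [y] because [z] is nearer to [y] than [x] is. So every step contributes one
    new class. *)
Lemma dist_card_sep x y : d x y = #|sep x y|.
Proof.
move En: (d x y) => n; elim: n x En => [|n IH] x En.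
  move/eqP: En; rewrite dist_eq0 // => /eqP->; symmetry; apply/eqP.
  rewrite cards_eq0; apply/eqP/setP => E; rewrite (sepD y).
  by rewrite addbb inE.
have [z exz dz] := dist_step econn En; rewrite (IH _ dz).
have [E Exz] := sep_edge exz.
have Ezy : E \notin sep z y.
  have: E \in sep x z by rewrite Exz set11.
  rewrite inE => /andP[ET]; rewrite inE ET /=.
  case/theta_classesP: ET => a [b [eab ->]]; rewrite !separates_edge_class //
    => cxz.
  have con : connect (opposite e) [set a; b] [set x; z] by rewrite connect_cut.
  rewrite -(edge_cutE _ _ eab) (connect_edge_cut con) edge_cutE //.
  rewrite -cut_swap // cut_edge_dist 1?eC //; lia.
have -> : sep x y = E |: sep z y.
  apply/setP => F; rewrite (sepD z) Exz !inE.
  by have [->|] //= := eqVneq F E; move: Ezy; rewrite inE => /negPf->.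
by rewrite cardsU1 Ezy.
Qed.

Lemma sepxx x : sep x x = set0.
Proof. by apply/eqP; rewrite -cards_eq0 -dist_card_sep distxx. Qed.

Lemma sep_eq0 x y : sep x y = set0 -> x = y.
Proof. by move/eqP; rewrite -cards_eq0 -dist_card_sep dist_eq0 // => /eqP. Qed.

Lemma sep_inj x : injective (sep x).
Proof.
move=> y z Eyz; apply: sep_eq0; apply/setP => E.
by rewrite (sepD x) sepC Eyz addbb inE.
Qed.

Lemma card_sep1 x y : (#|sep x y| == 1) = e x y.
Proof. by rewrite -dist_card_sep dist1. Qed.

(** [sep x y] is the symmetric difference of [sep x w] and [sep w y], so the triangle equality holds
    exactly when these two sets are disjoint. *)
Lemma interval_sep x y w : (w \in interval e x y) = (sep x w \subset sep x y).
Proof.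
have dj E : (E \in sep w y) = (E \in sep x w) (+) (E \in sep x y).
  by rewrite (sepD x) sepC.
rewrite inE !dist_card_sep; apply/idP/idP => [/eqP H|sb].
  have U : sep x w :|: sep w y = sep x y :|: (sep x w :&: sep w y).
    by apply/setP => E; rewrite !in_setU in_setI dj; case: (E \in sep x w);
      case: (E \in _).
  have I : sep x y :&: (sep x w :&: sep w y) = set0.
    by apply/setP => E; rewrite !in_setI dj in_set0; case: (E \in sep x w);
      case: (E \in _).
  have := cardsUI (sep x w) (sep w y); rewrite {}U; rewrite cardsU I cards0 H.
  move=> H0; have /eqP : #|sep x w :&: sep w y| = 0 by lia.
  rewrite cards_eq0 => /eqP/setP J; apply/subsetP => E; have := J E.
  by rewrite in_setI dj in_set0; case: (E \in sep x w); case: (E \in _).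
have -> : sep w y = sep x y :\: sep x w.
  apply/setP => E; rewrite in_setD dj; have := subsetP sb E.
  by case: (E \in sep x w); case: (E \in sep x y) => //= /(_ isT).
by rewrite cardsDS // subnKC // subset_leq_card.
Qed.

(** Each interval containing the median becomes an inclusion of separating sets; the three
    inclusions force the majority rule class by class. *)
Lemma sep_median x y z : exists m, sep x m = sep x y :&: sep x z.
Proof.
have [m [h1 h2 h3]] := median_ex x y z; exists m; apply/setP => E;
  rewrite in_setI.
have /subsetP/(_ E) : sep x m \subset sep x y by rewrite -interval_sep inE h1.
have /subsetP/(_ E) : sep y m \subset sep y z by rewrite -interval_sep inE h2.
have /subsetP/(_ E) : sep z m \subset sep z x by rewrite -interval_sep inE h3.
rewrite (sepD x y m) (sepD x y z) (sepD x z m) (sepC z x) (sepC y x).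
case: (E \in sep x m); case: (E \in sep x y);
  case: (E \in sep x z) => //= h k l;
  by [move: (h isT) | move: (k isT) | move: (l isT)].
Qed.

Local Notation classes := {set {set {set V}}}.

(** * Hypercubes *)

Definition incident (E : {set {set V}}) (x : V) : bool :=
  [exists z, [set x; z] \in E].

Lemma edge_sep E x y : E \in theta_classes e ->
  ([set x; y] \in E) = (sep x y == [set E]).
Proof.
move=> ET; rewrite mem_theta //; apply/andP/eqP => [[/sep_edge[F ->]] /set1P->//|
  Exy].
by rewrite Exy set11 -card_sep1 Exy cards1.
Qed.

Lemma incidentP E x : E \in theta_classes e ->
  reflect (exists z, sep x z = [set E]) (incident E x).
Proof.
move=> ET; apply: (iffP existsP) => [[z]|[z Ez]]; last first.
  by exists z; rewrite edge_sep ?Ez.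
by rewrite edge_sep // => /eqP; exists z.
Qed.

(** The 4-cycle witnessing orthogonality may lie far from [x]; a median carries it back to [x]. *)
Lemma orthogonal_square x x1 x2 E F :
  E \in theta_classes e -> F \in theta_classes e ->
  orthogonal e E F -> sep x x1 = [set E] -> sep x x2 = [set F] ->
  exists q, sep x q = [set E; F].
Proof.
move=> ET FT /existsP[a /existsP[b /existsP[c /existsP[c' /and5P[sq]]]]].
rewrite !edge_sep // => /eqP ab /eqP cc' /eqP bc /eqP c'a xx1 xx2.
have nEF : E != F.
  apply/eqP => EF; case/and5P: sq => _ _ _ _ /andP[/eqP nac _]; apply: nac.
  by apply: (@sep_inj b); rewrite sepC ab bc EF.
(* The corners of the 4-cycle realise all four combinations of sides of [E] and [F], so one of them
   lies across both classes from [x]. *)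
have [t Et Ft] : exists2 t, E \in sep x t & F \in sep x t.
  have Eb : E \in sep x b = ~~ (E \in sep x a) by rewrite (sepD a) ab set11
    addbT.
  have Fb : F \in sep x b = (F \in sep x a).
    by rewrite (sepD a) ab in_set1 eq_sym (negPf nEF) addbF.
  have Fc : F \in sep x c = ~~ (F \in sep x b) by rewrite (sepD b) bc set11
    addbT.
  have Ec : E \in sep x c = (E \in sep x b).
    by rewrite (sepD b) bc in_set1 (negPf nEF) addbF.
  have Fc' : F \in sep x c' = ~~ (F \in sep x a).
    by rewrite (sepD a) (sepC a) c'a set11 addbT.
  have Ec' : E \in sep x c' = (E \in sep x a).
    by rewrite (sepD a) (sepC a) c'a in_set1 (negPf nEF) addbF.
  case Ea: (E \in sep x a); case Fa: (F \in sep x a).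
  - by exists a.
  - by exists c'; rewrite ?Ec' ?Fc' ?Ea ?Fa.
  - by exists b; rewrite ?Eb ?Fb ?Ea ?Fa.
  - by exists c; rewrite ?Ec ?Fc ?Eb ?Fb ?Ea ?Fa.
(* In the majority of [x1], [x2] and [t], the vertex [t] decides for [E] and [F], while for any
   other class [x1] and [x2] both agree with [x]. *)
have [q Eq] := sep_median x1 x2 t; exists q; apply/setP => G.
rewrite (sepD x1) Eq in_setI (sepD x x1 x2) (sepD x x1 t) (sepC x1 x) xx1 xx2.
rewrite in_set2 !in_set1.
have [->|nGE] := eqVneq G E; first by rewrite (negPf nEF) Et.
by have [->|nGF] := eqVneq G F; rewrite ?Ft.
Qed.

Lemma square_orthogonal x x1 x2 q E F :
  E \in theta_classes e -> F \in theta_classes e ->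
  E != F -> sep x x1 = [set E] -> sep x x2 = [set F] -> sep x q = [set E; F] ->
  orthogonal e E F.
Proof.
move=> ET FT nEF xx1 xx2 xq.
have x1q : sep x1 q = [set F].
  apply/setP => G; rewrite (sepD x) (sepC x1) xx1 xq in_set2 !in_set1.
  by have [->|_] := eqVneq G E; rewrite // (negPf nEF).
have x2q : sep x2 q = [set E].
  apply/setP => G; rewrite (sepD x) (sepC x2) xx2 xq in_set2 !in_set1.
  by have [->|_] := eqVneq G F; rewrite ?orbT ?orbF ?addbF // eq_sym (negPf
    nEF).
apply/existsP; exists x; apply/existsP; exists x1; apply/existsP; exists q.
apply/existsP; exists x2; rewrite !edge_sep // xx1 x1q (sepC q) x2q (sepC x2)
  xx2.
rewrite !eqxx /= !andbT.
rewrite /four_cycle -!card_sep1 xx1 x1q (sepC q) x2q (sepC x2) xx2 !cards1 /=.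
apply/andP; split; apply: contraTneq isT => Eq.
  by have := set21 E F; rewrite -xq -Eq sepxx in_set0.
by have := set11 E; rewrite -xx1 Eq xx2 in_set1 (negPf nEF).
Qed.

Lemma POF_theta T E : POF e T -> E \in T -> E \in theta_classes e.
Proof. by case/andP=> /subsetP sT _ /sT. Qed.

Lemma POF_orthogonal T E F : POF e T -> E \in T -> F \in T -> E != F ->
  orthogonal e E F.
Proof.
by case/andP=> _ /forallP/(_ E)/implyP H /H/forallP/(_ F)/implyP{}H /H/implyP.
Qed.

Lemma POFP (T : classes) : {subset T <= theta_classes e} ->
  {in T &, forall E F, E != F -> orthogonal e E F} -> POF e T.
Proof.
move=> sT oT; apply/andP; split; first exact/subsetP.
by apply/forallP => E; apply/implyP => ET; apply/forallP => F;
  apply/implyP => FT; apply/implyP/oT.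
Qed.

Lemma POF_sub (T T' : classes) : T' \subset T -> POF e T -> POF e T'.
Proof.
move=> /subsetP sT pT; apply: POFP => [E /sT|E F /sT ET /sT FT];
  first exact: POF_theta pT.
exact: POF_orthogonal pT _ _.
Qed.

(* Crossing one class of [T] leaves the others incident, by orthogonality. *)
Lemma cube_vertex (T : classes) x : POF e T -> {in T, forall E, incident E x} ->
  exists y, sep x y = T.
Proof.
move En : #|T| => n; elim: n T x En => [|n IH] T x En pT iT.
  by move/eqP: En; rewrite cards_eq0 => /eqP->; exists x; rewrite sepxx.
have /card_gt0P[E ET] : 0 < #|T| by rewrite En.
have Eth := POF_theta pT ET.
have /(incidentP _ Eth)[x1 xx1] := iT _ ET.
have [||F|y x1y] := IH (T :\ E) x1.
- by move: En; rewrite (cardsD1 E) ET => -[].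
- exact: POF_sub (subsetDl _ _) pT.
- rewrite in_setD1 => /andP[nFE FT].
  have Fth := POF_theta pT FT; have /(incidentP _ Fth)[x2 xx2] := iT _ FT.
  have [|q xq] := orthogonal_square Eth Fth _ xx1 xx2.
    by apply: POF_orthogonal pT _ _ _ => //; rewrite eq_sym.
  apply/incidentP => //; exists q; apply/setP => G.
  rewrite (sepD x) (sepC x1) xx1 xq in_set2 !in_set1.
  by have [->|_] := eqVneq G E; rewrite // eq_sym (negPf nFE).
exists y; apply/setP => G; rewrite (sepD x1) xx1 x1y in_setD1 in_set1.
by have [->|] := eqVneq G E; rewrite // ET.
Qed.

Definition cube (x : V) (L : classes) : {set V} :=
  [set y | sep x y \subset L].

(** Each subset of [L] is the separating set of a unique vertex, so an enumeration of [L] supplies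
    the coordinates. *)
Lemma is_hypercube_cube x (L : classes) :
  POF e L -> {in L, forall E, incident E x} ->
  is_hypercube e (cube x L).
Proof.
move=> pL iL; have [y xy] := cube_vertex pL iL.
(* The dimension must be an element of ['I_#|V|]; it is the distance from [x] to the far corner
   [y]. *)
have ltk : #|L| < #|V| by rewrite -xy -dist_card_sep dist_lt_card.
pose D (i : 'I_#|L|) := enum_val i.
have Dinj : injective D by apply: enum_val_inj.
pose T (s : {ffun 'I_#|L| -> bool}) := [set D i | i in [set i | s i]].
have memT i s : (D i \in T s) = s i by rewrite mem_imset // inE.
have sTL s : T s \subset L by apply/subsetP => _ /imsetP[i _ ->];
  apply: enum_valP.
have /fin_all_exists[g Hg] : forall s, exists y, sep x y = T s.
  move=> s; apply: cube_vertex; first exact: POF_sub pL.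
  by move=> E /(subsetP (sTL s))/iL.
have sepg s t : sep (g s) (g t) = D @: [set i | s i != t i].
  apply/setP => E; rewrite (sepD x) (sepC _ x) !Hg.
  have [EL|EL] := boolP (E \in L).
    have -> : E = D (enum_rank_in EL E) by rewrite /D enum_rankK_in.
    by rewrite mem_imset // !memT inE; case: (s _); case: (t _).
  rewrite !(contraNF (subsetP (sTL _) E) EL); symmetry; apply: contraNF EL.
  by case/imsetP=> i _ ->; apply: enum_valP.
apply/existsP; exists (Ordinal ltk); apply/existsP; exists (finfun g) => /=.
apply/and3P; split.
- apply/injectiveP => s t; rewrite !ffunE => Est; apply/ffunP => i.
  have := memT i s; rewrite -Hg Est Hg memT; by [].
- apply/eqP/setP => z; rewrite inE; apply/idP/imsetP => [sz|[s _ ->]];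
    last first.
    by rewrite ffunE Hg.
  exists [ffun i => D i \in sep x z]; rewrite ?inE // ffunE.
  apply: (@sep_inj x); rewrite Hg; apply/setP => E.
  have [EL|EL] := boolP (E \in L).
    have -> : E = D (enum_rank_in EL E) by rewrite /D enum_rankK_in.
    by rewrite memT ffunE.
  by rewrite (contraNF (subsetP (sTL _) E) EL) (contraNF (subsetP sz E) EL).
- apply/forallP => s; apply/forallP => t; rewrite !ffunE -card_sep1 sepg
    card_imset //.
Qed.

Lemma mem_signature (Q : {set V}) E y z :
  y \in Q -> z \in Q -> sep y z = [set E] ->
  E \in signature e Q.
Proof.
move=> yQ zQ yz; have ET : E \in theta_classes e by apply: (@sep_theta y z);
  rewrite yz set11.
rewrite inE ET /=; apply/existsP; exists [set y; z].
by rewrite edge_sep // yz eqxx subUset !sub1set yQ.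
Qed.

Lemma signatureP (Q : {set V}) E :
  reflect (exists y z, [/\ y \in Q, z \in Q & sep y z = [set E]])
  (E \in signature e Q).
Proof.
apply: (iffP idP) => [|[y [z [yQ zQ yz]]]]; last exact: mem_signature yz.
rewrite inE => /andP[ET /existsP[a /andP[aE aQ]]].
have /theta_classesP[p [q [epq EE]]] := ET.
have /edgesP[y [z [eyz Ea]]] : a \in edges e by move: aE;
  rewrite EE inE => /andP[].
move: aE aQ; rewrite Ea edge_sep // subUset !sub1set => /eqP yz /andP[yQ zQ].
by exists y, z.
Qed.

Lemma signature_cube x (L : classes) :
  POF e L -> {in L, forall E, incident E x} ->
  signature e (cube x L) = L.
Proof.
move=> pL iL; apply/setP => E; apply/signatureP/idP => [[y [z]]|EL].
  rewrite !inE => -[/subsetP sy /subsetP sz yz].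
  have : E \in sep y z by rewrite yz set11.
  rewrite (sepD x) sepC; case Ey: (E \in sep x y); first by rewrite sy.
  by move=> /= Ez; rewrite sz.
have /incidentP[|z xz] := iL _ EL; first exact: POF_theta pL _.
by exists x, z; rewrite !inE sepxx sub0set xz sub1set.
Qed.

(** * Directions of the edges of a hypercube *)

Section HypercubeStructure.

Variables (k : nat) (f : {ffun {ffun 'I_k -> bool} -> V}).
Hypothesis finj : injective f.
Hypothesis fadj : forall s t, e (f s) (f t) = (#|[set i | s i != t i]| == 1).

Definition flip (i : 'I_k) (s : {ffun 'I_k -> bool}) : {ffun 'I_k -> bool} :=
  [ffun j => s j (+) (j == i)].

Lemma flipK i : involutive (flip i).
Proof. by move=> s; apply/ffunP => j; rewrite !ffunE -addbA addbb addbF. Qed.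

Lemma flip_comm i j s : flip i (flip j s) = flip j (flip i s).
Proof. by apply/ffunP => h; rewrite !ffunE -!addbA (addbC (h == j)). Qed.

Lemma flip2_neq i j s : i != j -> flip i (flip j s) != s.
Proof.
move=> nij; apply/eqP => /ffunP/(_ i); rewrite !ffunE eqxx (negPf nij) addbF
  addbT.
by case: (s i).
Qed.

Lemma flip_sep i s : exists E, sep (f s) (f (flip i s)) = [set E].
Proof.
apply: sep_edge; rewrite fadj (_ : [set _ | _] = [set i]) ?cards1 //.
by apply/setP => j; rewrite !inE ffunE; case: (s j); case: (j == i).
Qed.

(** Consecutive edges of the 4-cycle carry different classes, as otherwise two distinct corners
    would coincide; additivity around the cycle then puts the class of [ab] on the opposite edge. *)
Lemma flip_sep_flip i j s : i != j ->
  sep (f s) (f (flip i s)) = sep (f (flip j s)) (f (flip i (flip j s))).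
Proof.
move=> nij; set a := f s; set b := f (flip i s); set c' := f (flip j s);
  set c := f _.
have [E ab] : exists E, sep a b = [set E] by apply: flip_sep.
have [F bc] : exists F, sep b c = [set F] by rewrite /b /c flip_comm;
  apply: flip_sep.
have [G c'c] : exists G, sep c' c = [set G] by apply: flip_sep.
have [H ac'] : exists H, sep a c' = [set H] by apply: flip_sep.
have nEF : E != F.
  apply/eqP => EF; have := flip2_neq s nij; rewrite -(inj_eq finj) => /eqP;
    apply.
  by apply: (@sep_inj b); rewrite bc sepC ab EF.
have nEH : E != H.
  apply/eqP => EH; have := flip2_neq (flip j s) nij; rewrite flipK.
  rewrite -(inj_eq finj) => /eqP; apply; apply: (@sep_inj a).
  by rewrite ab ac' EH.
have : E \in sep c' c.
  by rewrite (sepD a) (sepC c') ac' (sepD b) ab bc !in_set1 eqxx (negPf nEF)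
    (negPf nEH).
by rewrite ab c'c => /set1P->.
Qed.

(** Induction on the Hamming distance from [s] to [t], correcting one coordinate at a time. *)
Lemma hamming_ind (t : {ffun 'I_k -> bool}) (P : {ffun 'I_k -> bool} -> Prop) :
  P t -> (forall (s : {ffun _ -> bool}) j, s j != t j -> P (flip j s) -> P s)
    -> forall s, P s.
Proof.
move=> Pt Pflip s; move En : #|[set i | s i != t i]| => n;
  elim: n s En => [|n IH] s En.
  suff -> : s = t by [].
  apply/ffunP => i; apply/eqP; apply: contra_eqT En => nst.
  by rewrite -lt0n; apply/card_gt0P; exists i; rewrite inE.
have /card_gt0P[j] : 0 < #|[set i | s i != t i]| by rewrite En.
rewrite inE => nj; apply: (Pflip s j nj); apply: IH.
move: En; rewrite (cardsD1 j) inE nj => -[<-]; apply: eq_card => i.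
rewrite !inE ffunE; have [->|_] := eqVneq i j; last by rewrite addbF.
by move: nj; case: (s j); case: (t j).
Qed.

Lemma flip_sep_const i s t : sep (f s) (f (flip i s)) = sep (f t) (f (flip i
  t)).
Proof.
elim/(@hamming_ind t): s => // s j _ <-; have [->|nij] := eqVneq i j.
  by rewrite flipK sepC.
exact: flip_sep_flip.
Qed.

(** [D i] is the class crossed on flipping coordinate [i], the same at every vertex. If [D i]
    equalled [D j] with [i != j], flipping [j] and then [i] would lead back to the start. *)
Lemma direction_ex : exists D : 'I_k -> {set {set V}},
  injective D /\ forall s t, sep (f s) (f t) = D @: [set i | s i != t i].
Proof.
have /fin_all_exists[D HD] : forall i, exists E, forall s, sep (f s) (f (flip i
  s)) = [set E].
  move=> i; have [E HE] := flip_sep i [ffun => false]; exists E => s.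
  by rewrite -HE; apply: flip_sep_const.
have Dinj : injective D.
  move=> i j Dij; apply/eqP; apply/idP; apply: contraTT isT => nij.
  have := flip2_neq [ffun => false] nij; rewrite -(inj_eq finj) => /eqP; case.
  set s := [ffun => _]; apply: (@sep_inj (f (flip j s))).
  by rewrite HD sepC HD Dij.
exists D; split=> // s t; elim/(@hamming_ind t): s => [|s j nj IH].
  rewrite sepxx (_ : [set i | _] = set0) ?imset0 //.
  by apply/setP => i; rewrite !inE eqxx.
have -> : [set i | s i != t i] = j |: [set i | flip j s i != t i].
  apply/setP => i; rewrite !inE ffunE; have [->|_] := eqVneq i j;
    last by rewrite addbF.
  by rewrite nj.
apply/setP => E; rewrite (sepD (f (flip j s))) HD IH imsetU1 in_setU1 in_set1.
have [->|] //= := eqVneq E (D j); rewrite mem_imset // inE ffunE eqxx.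
by move: nj; case: (s j); case: (t j).
Qed.

End HypercubeStructure.

Lemma hypercube_cube (Q : {set V}) x : is_hypercube e Q -> x \in Q ->
  Q = cube x (signature e Q) /\
  forall T : classes, T \subset signature e Q -> exists y, sep x y = T.
Proof.
case/existsP=> k /existsP[f /and3P[/injectiveP finj /eqP EQ /forallP fadj]] xQ.
have [|D [Dinj sepf]] := direction_ex finj.
  by move=> s t; have /forallP/(_ t)/eqP := fadj s.
have sigE : signature e Q = D @: [set: 'I_k].
  apply/setP => E; apply/signatureP/imsetP => [[y [z [yQ zQ yz]]]|[i _ ->]].
    move: yQ zQ yz; rewrite EQ => /imsetP[s _ ->] /imsetP[t _ ->];
      rewrite sepf => H.
    have /imsetP[i _ ->] : E \in D @: [set i | s i != t i] by rewrite H set11.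
    by exists i.
  pose s : {ffun 'I_k -> bool} := [ffun => false].
  exists (f s), (f (flip i s)); rewrite EQ !imset_f ?inE //; split=> //.
  rewrite sepf (_ : [set j | _] = [set i]) ?imset_set1 //.
  by apply/setP => j; rewrite !inE !ffunE; case: (j == i).
move: (xQ); rewrite {1}EQ => /imsetP[s _ Ex].
have vert (T : classes) : T \subset D @: [set: 'I_k] -> exists2 y, y \in Q &
  sep x y = T.
  (* Relative to the coordinates [s] of [x], exactly the directions in [T] are flipped. *)
  move=> sT; exists (f [ffun i => s i (+) (D i \in T)]);
    first by rewrite EQ imset_f ?inE.
  rewrite Ex sepf; apply/setP => E; apply/imsetP/idP => [[i]|ET].
    by rewrite inE ffunE => + ->; case: (s i); case: (D i \in T).
  have /imsetP[i _ Ei] := subsetP sT _ ET; exists i => //.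
  by rewrite inE ffunE -Ei ET; case: (s i).
rewrite sigE; split; last by move=> T /vert[y _]; exists y.
apply/setP => y; rewrite inE; apply/idP/idP => [|/vert[z zQ /sep_inj <-//]].
by rewrite EQ Ex => /imsetP[t _ ->]; rewrite sepf imsetS // subsetT.
Qed.

(** * Ladder sets and milestones *)

Section Basepoint.

Variable v0 : V.

Local Notation below x y := (x \in interval e v0 y).

(** [sep v0 y] is the symmetric difference of [sep v0 x] and [sep x y]; it contains [sep v0 x]
    exactly when these two are disjoint. *)
Lemma belowP x y : reflect {in sep x y, forall E, E \notin sep v0 x} (below x
  y).
Proof.
rewrite interval_sep; apply: (iffP subsetP) => [H E Exy|H E E0x].
  by apply/negP => E0x; have := H E E0x; rewrite (sepD x) E0x Exy.
by rewrite (sepD x) E0x; apply: contraTN E0x => /H.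
Qed.

Lemma dist_below x y : below x y -> d v0 y = d v0 x + d x y.
Proof. by rewrite inE => /eqP. Qed.

(** Crossing a class that already separates [v0] from [x] would bring the neighbour closer to
    [v0]. *)
Lemma outgoing_incident x L : POF e L -> outgoing e v0 x L ->
  {in L, forall E, incident E x /\ E \notin sep v0 x}.
Proof.
move=> pL /forallP oL E EL; have /implyP/(_ EL)/existsP[y /andP[Exy lt_xy]] :=
  oL E.
split; first by apply/existsP; exists y.
move: Exy; rewrite (edge_sep _ _ (POF_theta pL EL)) => /eqP xy.
apply: contraTN lt_xy => E0x; rewrite -leqNgt !dist_card_sep;
  apply: subset_leq_card.
apply/subsetP => F; rewrite (sepD x) xy in_set1.
by have [->|_] := eqVneq F E; rewrite ?E0x // addbF.
Qed.

(** * Cubes directed away from the basepoint *)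

Section Upward.

Variables (x : V) (L : classes).
Hypothesis pL : POF e L.
Hypothesis iL : {in L, forall E, incident E x}.
Hypothesis oL : {in L, forall E, E \notin sep v0 x}.

Lemma below_cube z : z \in cube x L -> below x z.
Proof. by rewrite inE => /subsetP sz; apply/belowP => E /sz/oL. Qed.

Lemma is_basis_cube : is_basis e v0 (cube x L) x.
Proof.
apply/andP; split; first by rewrite inE sepxx sub0set.
by apply/forallP => z; apply/implyP => /below_cube/dist_below->;
  apply: leq_addr.
Qed.

(** Any hypercube through [x] is determined by its signature, and [cube x L] itself qualifies, so
    [pick] does not fall back on its default. *)
Lemma hypercube_sigE : hypercube_sig e v0 x L = cube x L.
Proof.
rewrite /hypercube_sig; case: pickP => [Q /and3P[hQ /andP[xQ _] /eqP sQ]|/(_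
  (cube x L))] /=.
  by have [-> _] := hypercube_cube hQ xQ; rewrite sQ.
by rewrite is_hypercube_cube // is_basis_cube signature_cube // eqxx.
Qed.

Lemma is_antibasis_cube y : is_antibasis e v0 (cube x L) y = (sep x y == L).
Proof.
have [w xw] := cube_vertex pL iL.
have wQ : w \in cube x L by rewrite inE xw.
apply/andP/eqP => [[yQ /forallP/(_ w)/implyP/(_ wQ)]|xy].
  rewrite (dist_below (below_cube wQ)) (dist_below (below_cube yQ)) leq_add2l
    !dist_card_sep xw => le_y.
  by apply/eqP; rewrite eqEcard le_y andbT; move: yQ; rewrite inE.
have yQ : y \in cube x L by rewrite inE xy.
split=> //; apply/forallP => z; apply/implyP => zQ.
rewrite (dist_below (below_cube zQ)) (dist_below (below_cube yQ)) leq_add2l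
  !dist_card_sep xy subset_leq_card //.
by move: zQ; rewrite inE.
Qed.

Lemma sep_antibasis : sep x (antibasis e v0 x L) = L.
Proof.
rewrite /antibasis hypercube_sigE; case: pickP => [w|none] /=.
  by rewrite is_antibasis_cube => /eqP.
by have [w xw] := cube_vertex pL iL; have := none w;
  rewrite is_antibasis_cube xw eqxx.
Qed.

Lemma signature_hypercube_between y : sep x y = L ->
  signature e (hypercube_between e v0 x y) = L.
Proof.
move=> xy; rewrite /hypercube_between; case: pickP => [Q|/(_ (cube x L))] /=;
  last first.
  by rewrite is_hypercube_cube // is_basis_cube is_antibasis_cube xy eqxx.
case/and3P=> hQ /andP[xQ /forallP bQ] /andP[yQ /forallP aQ].
have [EQ vQ] := hypercube_cube hQ xQ.
have memQ z : (z \in Q) = (sep x z \subset signature e Q) by rewrite {1}EQ inE.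
(* A class of the signature separating [v0] from [x] would give a neighbour [t] of [x] in [Q] closer
   to [v0], against the choice of the basis. *)
have upQ z : z \in Q -> below x z.
  rewrite memQ => sz; apply/belowP => E Exz; apply/negP => E0x.
  have [t xt] : exists t, sep x t = [set E] by apply: vQ;
    rewrite sub1set (subsetP sz).
  have tQ : t \in Q by rewrite memQ xt sub1set (subsetP sz).
  have := implyP (bQ t) tQ; rewrite leqNgt => /negP; apply.
  rewrite !dist_card_sep; apply: proper_card; apply/properP; split.
    apply/subsetP => F; rewrite (sepD x) xt in_set1.
    by have [->|_] := eqVneq F E; rewrite ?E0x // addbF.
  by exists E; rewrite // (sepD x) E0x xt set11.
(* The corner across the whole signature: as [y] is at least as far from [v0], it must be that
   corner too. *)
have [w xw] := vQ _ (subxx _).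
have wQ : w \in Q by rewrite memQ xw.
have := implyP (aQ w) wQ; rewrite (dist_below (upQ _ wQ)) (dist_below (upQ _
  yQ)) leq_add2l !dist_card_sep xw -xy => le_y.
by apply/eqP; rewrite eq_sym eqEcard le_y andbT -memQ.
Qed.

End Upward.

(** * Ladder sets and the recursion along milestones *)

Lemma mem_ladder x y E : (E \in ladder e x y) = (E \in sep x y) && incident E x.
Proof. by rewrite !inE andbA. Qed.

(** For two classes of the ladder, the median of [y] and the neighbours of [x] across them completes
    a 4-cycle at [x]. *)
Lemma ladder_POF x y : POF e (ladder e x y).
Proof.
apply: POFP => [E|E F]; rewrite !mem_ladder; first by case/andP=> /sep_theta.
case/andP=> Exy iE /andP[Fxy iF] nEF.
have Eth := sep_theta Exy; have Fth := sep_theta Fxy.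
have /(incidentP _ Eth)[x1 xx1] := iE; have /(incidentP _ Fth)[x2 xx2] := iF.
have [q Eq] := sep_median x1 x2 y.
apply: (square_orthogonal (q := q) Eth Fth nEF xx1 xx2); apply/setP => G.
rewrite (sepD x1) Eq in_setI (sepD x x1 x2) (sepD x x1 y) (sepC x1 x) xx1 xx2.
rewrite in_set2 !in_set1.
have [->|nGE] := eqVneq G E; first by rewrite (negPf nEF) Exy.
by have [->|nGF] := eqVneq G F; rewrite ?Fxy.
Qed.

(** The first edge of a geodesic from [x] to [y] always crosses a class of the ladder. *)
Lemma ladder_eq0 x y : ladder e x y = set0 -> x = y.
Proof.
move=> lad0; apply/eqP; rewrite -(dist_eq0 econn); case En: (d x y) => [//|n].
have [z exz dz] := dist_step econn En; have [E xz] := sep_edge exz.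
have Eth : E \in theta_classes e by apply: (@sep_theta x z); rewrite xz set11.
suff : E \in ladder e x y by rewrite lad0 in_set0.
rewrite mem_ladder; apply/andP; split; last by apply/incidentP => //; exists z.
have : sep x z \subset sep x y.
  rewrite -interval_sep inE En dz; have := exz; rewrite -dist1 => /eqP->;
    by rewrite add1n.
by rewrite xz sub1set.
Qed.

Lemma sep_next x y : below x y -> sep x (next_milestone e v0 x y) = ladder e x
  y.
Proof.
move=> /belowP bxy; apply: sep_antibasis; first exact: ladder_POF.
  by move=> E; rewrite mem_ladder => /andP[].
by move=> E; rewrite mem_ladder => /andP[/bxy].
Qed.

Lemma ladder_sub x y : ladder e x y \subset sep x y.
Proof. by apply/subsetP => E; rewrite mem_ladder => /andP[]. Qed.

Lemma below_next x y : below x y -> below (next_milestone e v0 x y) y.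
Proof.
move=> bxy; have Nx := sep_next bxy; move/belowP: bxy => bxy; apply/belowP => E.
rewrite (sepD x v0) (sepD x) (sepC _ x) Nx.
have := subsetP (ladder_sub x y) E; case: (E \in ladder e x y) => [/(_ isT) ->
  //|_].
by rewrite addbF => /bxy.
Qed.

Lemma dist_next x y : below x y -> x != y -> d (next_milestone e v0 x y) y < d
  x y.
Proof.
move=> bxy nxy; set x' := next_milestone e v0 x y.
have : x' \in interval e x y by rewrite interval_sep sep_next // ladder_sub.
rewrite inE => /eqP <-; rewrite -[X in X < _]add0n ltn_add2r lt0n dist_eq0 //.
apply: contraNneq nxy => Ex; apply/eqP/ladder_eq0.
by rewrite -sep_next // -/x' -Ex sepxx.
Qed.

Lemma next_id x y : x = y -> next_milestone e v0 x y = y.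
Proof.
move=> ->; apply/esym/(@sep_inj y); rewrite sepxx sep_next;
  last by rewrite interval_sep.
by apply/esym/eqP; rewrite -subset0 -(sepxx y) ladder_sub.
Qed.

(** Each recursive call strictly lowers the distance to [y], so fuel equal to the distance suffices;
    without fuel [x = y], and both branches return the same set. *)
Lemma milestones_rec_fuel n m x y : below x y -> d x y <= n -> d x y <= m ->
  milestones_rec e v0 n x y = milestones_rec e v0 m x y.
Proof.
elim: n m x => [|n IH] [|m] x bxy //=.
- rewrite leqn0 => dxy _; rewrite next_id ?eqxx //; by apply/eqP;
    rewrite -(dist_eq0 econn).
- rewrite leqn0 => _ dxy; rewrite next_id ?eqxx //; by apply/eqP;
    rewrite -(dist_eq0 econn).
move=> dn dm; case: eqP => // nN; congr (_ |: _); have [xy|nxy] := eqVneq x y.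
  by rewrite next_id in nN.
by apply: IH; rewrite ?below_next // -ltnS; apply: leq_trans (dist_next bxy
  nxy) _.
Qed.

(* When [x = y] this relies on [next_milestone y y = y]. *)
Lemma milestones_next x y : below x y ->
  milestones e v0 x y = x |: milestones e v0 (next_milestone e v0 x y) y.
Proof.
move=> bxy; have lt_d z : d z y < #|V| by apply: dist_lt_card.
rewrite /milestones; case EV: #|V| => [|n]; first by have := lt_d x; rewrite EV.
rewrite {1}/milestones_rec -/milestones_rec; set x' := next_milestone e v0 x y.
have [x'y|nx'] := eqVneq x' y.
  by rewrite x'y /= next_id // eqxx setUid.
congr (_ |: _); apply: milestones_rec_fuel; first exact: below_next.
  by rewrite -ltnS -EV.
by rewrite -EV ltnW.
Qed.

Lemma milestonesxx y : milestones e v0 y y = [set y].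
Proof.
rewrite /milestones; case: #|V| => [|n] /=; first by rewrite setUid.
by rewrite next_id // eqxx setUid.
Qed.

Lemma below_ind y (P : V -> Prop) : P y ->
  (forall x, below x y -> x != y -> P (next_milestone e v0 x y) -> P x) ->
  forall x, below x y -> P x.
Proof.
move=> Py Pnext x; move En: (d x y) => n; elim/ltn_ind: n x En => n IH x En bxy.
have [->|nxy] := eqVneq x y; first by [].
by apply: Pnext => //; apply: (IH _ _ _ erefl);
  rewrite ?below_next // -En dist_next.
Qed.

Lemma milestones_start x y : below x y -> x \in milestones e v0 x y.
Proof. by move=> /milestones_next->; apply: setU11. Qed.

Lemma milestones_end x y : below x y -> y \in milestones e v0 x y.
Proof.
move: x; apply: below_ind => [|x bxy _ IH]; first by rewrite milestonesxx set11.
by rewrite milestones_next // in_setU1 IH orbT.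
Qed.

Lemma belowxx y : below y y.
Proof. by rewrite interval_sep. Qed.

(** In terms of intervals: with [z] in [I(x,y)], every [t] in [I(z,y)] is in [I(x,y)]. *)
Lemma sep_trans z x y : sep x z \subset sep x y -> forall t,
  sep z t \subset sep z y -> sep x t \subset sep x y.
Proof.
move=> /subsetP sz t /subsetP st; apply/subsetP => E; have := sz E;
  have := st E.
rewrite (sepD z x t) (sepD x z y) (sepC z x).
by case: (E \in sep x z); case: (E \in sep x y);
  case: (E \in sep z t) => // [/(_ isT)|] // _ /(_ isT).
Qed.

Lemma milestones_sep x y m : below x y -> m \in milestones e v0 x y ->
  sep x m \subset sep x y.
Proof.
move=> bxy; move: x bxy m; apply: below_ind => [m|x bxy _ IH m].
  by rewrite milestonesxx => /set1P->.
rewrite milestones_next // => /setU1P[->|/IH]; first by rewrite sepxx sub0set.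
by apply: sep_trans; rewrite sep_next // ladder_sub.
Qed.

Lemma milestones_below x y m : below x y -> m \in milestones e v0 x y -> below
  m y.
Proof.
move=> bxy; move: x bxy; apply: below_ind => [|x bxy _ IH].
  by rewrite milestonesxx => /set1P->; apply: belowxx.
by rewrite milestones_next // => /setU1P[->|/IH].
Qed.

Lemma milestones_next_mem x y m : below x y -> m \in milestones e v0 x y ->
  next_milestone e v0 m y \in milestones e v0 x y.
Proof.
move=> bxy; move: x bxy; apply: below_ind => [|x bxy _ IH].
  by rewrite milestonesxx => /set1P->; rewrite next_id // set11.
rewrite milestones_next // => /setU1P[->|/IH IHm]; rewrite in_setU1;
  last by rewrite IHm orbT.
by rewrite milestones_start ?orbT // below_next.
Qed.

(** Milestones are linearly ordered, and none lies strictly between a milestone and its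
    successor. *)
Lemma milestones_chain x y m m' : below x y ->
  m \in milestones e v0 x y -> m' \in milestones e v0 x y ->
  sep x m' \subset sep x m \/ sep x (next_milestone e v0 m y) \subset sep x m'.
Proof.
move=> bxy; move: x bxy; apply: below_ind => [|x bxy _ IH].
  by rewrite milestonesxx => /set1P-> /set1P->; left.
rewrite milestones_next // => /setU1P[->|mN] /setU1P[->|m'N].
- by left.
- right; have bN := below_next bxy; rewrite sep_next //; apply/subsetP => E EL.
  have Exy := subsetP (ladder_sub x y) E EL.
  have := subsetP (milestones_sep bN m'N) E.
  rewrite (sepD x _ m') (sepD x _ y) (sepC _ x) sep_next // EL Exy.
  by case: (E \in sep x m') => // /(_ isT).
- by left; rewrite sepxx sub0set.
have bN := below_next bxy; have Nx := sep_next bxy.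
set x' := next_milestone e v0 x y in IH bN Nx mN m'N *.
(* Comparisons seen from [x'] transfer to [x]: both vertices lie beyond [x'], so [sep x x'] is added
   disjointly on both sides. *)
have tr a b : a \in milestones e v0 x' y -> b \in milestones e v0 x' y ->
    sep x' a \subset sep x' b -> sep x a \subset sep x b.
  move=> aM bM /subsetP sab; apply/subsetP => E.
  have := sab E; have := subsetP (milestones_sep bN aM) E.
  have := subsetP (milestones_sep bN bM) E; have := subsetP (ladder_sub x y) E.
  rewrite -Nx (sepD x x' a) (sepD x x' b) (sepD x x' y) (sepC x' x).
  case: (E \in sep x x'); case: (E \in sep x a); case: (E \in sep x b);
    case: (E \in sep x y) => //= h1 h2 h3 h4 _;
   by [move: (h1 isT)|move: (h2 isT)|move: (h3 isT)|move: (h4 isT)].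
by case: (IH mN m'N) => [/(tr _ _ m'N mN)|/tr H]; [left|right; apply: H;
  rewrite // milestones_next_mem].
Qed.

(** * The penultimate milestone *)

Lemma penultimateP x y : below x y -> x != y ->
  [/\ penultimate e v0 x y \in milestones e v0 x y, penultimate e v0 x y != y
    & {in milestones e v0 x y, forall m, m != y -> d (penultimate e v0 x y) y
      <= d m y}].
Proof.
move=> bxy nxy; rewrite /penultimate; case: arg_minnP.
  by rewrite in_setD1 nxy milestones_start.
move=> p; rewrite in_setD1 => /andP[npy pM] minp; split=> // m mM nmy.
by apply: minp; rewrite in_setD1 nmy.
Qed.

(** Otherwise the successor would be a milestone other than [y] and strictly closer to [y]. *)
Lemma next_penultimate x y : below x y -> x != y ->
  next_milestone e v0 (penultimate e v0 x y) y = y.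
Proof.
move=> bxy nxy; have [pM npy minp] := penultimateP bxy nxy.
have := minp _ (milestones_next_mem bxy pM); case: eqP => //= _ /(_ isT).
by rewrite leqNgt dist_next // (milestones_below bxy).
Qed.

Lemma ladder_penultimate x y : below x y -> x != y ->
  ladder e (penultimate e v0 x y) y = sep (penultimate e v0 x y) y.
Proof.
move=> bxy nxy; have [pM _ _] := penultimateP bxy nxy.
by rewrite -sep_next ?next_penultimate // (milestones_below bxy).
Qed.

Lemma penultimate_classesE x y : below x y -> x != y ->
  penultimate_classes e v0 x y = sep (penultimate e v0 x y) y.
Proof.
move=> bxy nxy; have [pM _ _] := penultimateP bxy nxy.
have lad := ladder_penultimate bxy nxy.
apply: signature_hypercube_between => //; first by rewrite -lad ladder_POF.
  by move=> E; rewrite -lad mem_ladder => /andP[].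
by apply/belowP; apply: milestones_below bxy pM.
Qed.

(* The median of [p] and the neighbours of [x] and [y] across [E] differs from
   [p] exactly in [E]. *)
Lemma incident_convex E x y p : E \in theta_classes e ->
  incident E x -> incident E y -> E \notin sep x y -> sep x p \subset sep x y ->
  incident E p.
Proof.
move=> ET /(incidentP _ ET)[x1 xx1] /(incidentP _ ET)[y1 yy1] nE /subsetP sp.
have [m pm] := sep_median p x1 y1; apply/incidentP => //; exists m.
apply/setP => F; rewrite pm in_setI (sepD x p x1) (sepD x p y1) (sepD y x y1)
  xx1 yy1.
rewrite (sepC p) !in_set1; have [->|_] := eqVneq F E.
  by rewrite (negPf nE) addbT; case Ep : (E \in sep x p) => //;
    rewrite (sp _ Ep) in nE.
rewrite !addbF; have := sp F; case: (F \in sep x p) => //= /(_ isT) ->; by [].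
Qed.

Lemma ladder_eq x y y' : sep x y \subset sep x y' ->
  {in ladder e x y', forall E, E \in sep x y} -> ladder e x y' = ladder e x y.
Proof.
move=> /subsetP s H; apply/setP => E; apply/idP/idP => [El|].
  by move: (El); rewrite !mem_ladder H // => /andP[].
by rewrite !mem_ladder => /andP[/s -> ->].
Qed.

Lemma next_eq x y y' : ladder e x y' = ladder e x y ->
  next_milestone e v0 x y' = next_milestone e v0 x y.
Proof. by rewrite /next_milestone => ->. Qed.

(** As long as [v] lies ahead, the next milestone towards [w] does not pass [v], so the ladders
    towards [w] and towards [v] agree; [w] follows [v]. *)
Lemma milestones_prefix v w x : below v w -> v != w ->
  next_milestone e v0 v w = w -> below x w -> v \in milestones e v0 x w ->
  milestones e v0 x w = w |: milestones e v0 x v.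
Proof.
move=> bvw nvw Nvw bxw; move: x bxw; apply: below_ind => [|x bxw nxw IH].
  by rewrite milestonesxx => /set1P vw; rewrite vw eqxx in nvw.
have [-> _|nxv] := eqVneq x v.
  by rewrite milestones_next // Nvw !milestonesxx setUC.
rewrite (milestones_next bxw) => /setU1P[vx|vM];
  first by rewrite vx eqxx in nxv.
have bN := below_next bxw.
have svN : sep x (next_milestone e v0 x w) \subset sep x v.
  have [] := milestones_chain bxw (milestones_start bxw) (m' := v) => //.
    by rewrite milestones_next // in_setU1 vM orbT.
  by rewrite sepxx subset0 => /eqP/sep_eq0 xv; rewrite xv eqxx in nxv.
have sv : sep x v \subset sep x w.
  by apply: milestones_sep => //; rewrite milestones_next // in_setU1 vM orbT.
have bxv : below x v.
  by apply/belowP => E /(subsetP sv); move: E; apply/belowP.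
have NN : next_milestone e v0 x w = next_milestone e v0 x v.
  apply/next_eq/ladder_eq => // E; rewrite -sep_next //; exact: subsetP.
by rewrite IH // NN (milestones_next bxv) setUCA.
Qed.

(** * Extending by an outgoing cube at [v] *)

Section Extension.

Variables (u v w : V) (L : classes).
Hypothesis buv : below u v.
Hypothesis pL : POF e L.
Hypothesis oL : {in L, forall E, incident E v /\ E \notin sep v0 v}.
Hypothesis vw : sep v w = L.

Let bvw : below v w.
Proof. by apply/belowP => E; rewrite vw => /oL[]. Qed.

Lemma below_extend x : below x v -> below x w.
Proof.
rewrite !interval_sep => sx; apply: subset_trans sx _; by rewrite -interval_sep.
Qed.

(** A class of [L] cannot separate [x] from [v], since it would then separate [v0] from [v]; the
    union is therefore disjoint. *)
Lemma sep_extend x : below x v -> sep x w = sep x v :|: L.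
Proof.
move=> /belowP bxv; apply/setP => E; rewrite (sepD v) vw in_setU.
have [EL|] := boolP (E \in L); last by rewrite addbF orbF.
have [_] := oL EL; rewrite (sepD x v0) => E0v; case Exv: (E \in sep x v) => //.
by move: E0v; rewrite (negPf (bxv _ Exv)) Exv.
Qed.

Lemma extend_notin x E : below x v -> E \in L -> E \notin sep x v.
Proof.
move=> bxv EL; have [_] := oL EL; apply: contra => Exv.
by rewrite (sepD x) (negPf (belowP _ _ bxv E Exv)) Exv.
Qed.

Lemma next_extend : next_milestone e v0 v w = w.
Proof.
apply: (@sep_inj v); rewrite sep_next // vw; apply/setP => E;
  rewrite mem_ladder vw.
by case EL: (E \in L) => //=; have [-> _] := oL EL.
Qed.

Section Penultimate.

Hypothesis nL0 : L != set0.

Let nvw : v != w.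
Proof. by apply: contraNneq nL0 => Evw; rewrite -vw Evw sepxx. Qed.

Let nuw : u != w.
Proof.
apply: contraNneq nL0 => uw; apply/eqP/setP => E; rewrite in_set0;
  apply/negP => EL.
have := sep_extend buv; rewrite uw sepxx => /setP/(_ E).
by rewrite in_set0 in_setU EL orbT.
Qed.

Lemma penultimate_milestones : penultimate e v0 u w = v <->
  milestones e v0 u w = milestones e v0 u v :|: [set w].
Proof.
have buw := below_extend buv; have [pM npw minp] := penultimateP buw nuw.
split=> [Ep|EM].
  by rewrite setUC; apply: milestones_prefix => //;
    [exact: next_extend | rewrite -{1}Ep].
have pv : penultimate e v0 u w \in milestones e v0 u v.
  by move: pM; rewrite EM in_setU in_set1 (negPf npw) orbF.
(* By minimality the penultimate milestone is no farther from [w] than [v] is; but its distance to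
   [w] is its distance to [v] plus [#|L|], so it equals [v]. *)
have := minp v; rewrite EM in_setU milestones_end // => /(_ isT nvw).
have bpv := milestones_below buv pv.
rewrite !dist_card_sep sep_extend // vw cardsU (_ : _ :&: L = set0); last first.
  apply/setP => E; rewrite in_setI in_set0; apply/negP => /andP[Epv EL].
  by have := extend_notin bpv EL; rewrite Epv.
rewrite cards0 subn0 -[X in _ <= X]add0n leq_add2r leqn0 cards_eq0 => /eqP.
exact: sep_eq0.
Qed.

End Penultimate.

Section NonPOF.

Hypothesis nuv : u != v.

Let p := penultimate e v0 u v.
Let pM : p \in milestones e v0 u v. Proof. by have [] := penultimateP buv nuv.
  Qed.
Let bpv : below p v. Proof. exact: milestones_below buv pM. Qed.
Let npv : p != v. Proof. by have [] := penultimateP buv nuv. Qed.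
Let lad_p : ladder e p v = sep p v. Proof. exact: ladder_penultimate. Qed.

Lemma milestones_extend :
  {in L, forall E, ~~ POF e (sep p v :|: [set E])} ->
  milestones e v0 u w = milestones e v0 u v :|: [set w].
Proof.
move=> nPOF; rewrite setUC.
(* Stated so that [u] can be replaced by any later milestone [x]: until [v] is reached, [p] is still
   ahead, and incidence can be carried from [x] to [p]. *)
suff: u = v \/ p \in milestones e v0 u v -> milestones e v0 u w = w |:
  milestones e v0 u v.
  by apply; right.
move: u buv; apply: below_ind => [_|x bxv nxv IH xp].
  by rewrite (milestones_next bvw) next_extend !milestonesxx setUC.
have px : p \in milestones e v0 x v by case: xp => // xv;
  rewrite xv eqxx in nxv.
have bxw := below_extend bxv.
have sxw : sep x v \subset sep x w by rewrite sep_extend // subsetUl.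
have lad : ladder e x w = ladder e x v.
  apply: ladder_eq => // E; rewrite mem_ladder sep_extend // in_setU => /andP[+
    iEx].
  case/orP=> // EL; have Eth := POF_theta pL EL; have [iEv _] := oL EL.
  have iEp := incident_convex Eth iEx iEv (extend_notin bxv EL) (milestones_sep
    bxv px).
  case/negP: (nPOF E EL); apply: POF_sub (ladder_POF p w).
  apply/subsetP => F; rewrite mem_ladder sep_extend // !in_setU in_set1.
  case/orP=> [|/eqP->]; last by rewrite EL orbT.
  by rewrite -lad_p mem_ladder => /andP[-> ->].
rewrite (milestones_next bxw) (milestones_next bxv) (next_eq lad) setUCA IH //.
move: px; rewrite (milestones_next bxv) => /setU1P[Ep|pN]; last by right.
by left; rewrite -Ep next_penultimate.
Qed.

Lemma milestones_not_POF :
  milestones e v0 u w = milestones e v0 u v :|: [set w] ->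
  {in L, forall E, ~~ POF e (sep p v :|: [set E])}.
Proof.
move=> EM E EL; apply/negP => pE; have Eth := POF_theta pL EL.
have Epv := extend_notin bpv EL; have Euv := extend_notin buv EL.
have pOF : POF e (sep p v) by rewrite -lad_p ladder_POF.
have iv : {in sep p v :|: [set E], forall F, incident F v}.
  move=> F; rewrite in_setU in_set1 => /orP[Fpv|/eqP->];
    last by have [] := oL EL.
  (* The corner of the cube from [p] to [v] that is the neighbour of [v] across [F]. *)
  have [||z pz] := @cube_vertex (sep p v :\ F) p;
    first exact: POF_sub (subsetDl _ _) pOF.
    by move=> G; rewrite -lad_p in_setD1 mem_ladder => /and3P[].
  apply/incidentP; first exact: sep_theta Fpv.
  exists z; apply/setP => G; rewrite (sepD p) (sepC v) pz in_setD1 in_set1.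
  by have [->|_] := eqVneq G F; rewrite ?Fpv // addbb.
(* The corner opposite to [v] differs from [p] in [E] only, so it is the neighbour of [p] across
   [E]. *)
have [z vz] := cube_vertex pE iv.
have iEp : incident E p.
  apply/incidentP => //; exists z; apply/setP => G;
    rewrite (sepD v) vz in_setU in_set1.
  have [->|_] := eqVneq G E; first by rewrite (negPf Epv).
  by rewrite orbF addbb.
have buw := below_extend buv; have bpw := below_extend bpv.
have pMw : p \in milestones e v0 u w by rewrite EM in_setU pM.
have vMw : v \in milestones e v0 u w by rewrite EM in_setU milestones_end.
have EpN : E \in sep p (next_milestone e v0 p w).
  by rewrite sep_next // mem_ladder sep_extend // in_setU EL orbT.
have Eup : E \notin sep u p.
  by apply: contra Euv; apply: subsetP; apply: milestones_sep.
(* No milestone of [(u, v)] lies across [E] from [u], but the successor of [p] towards [w] does;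
   only [w] remains. *)
have Npw : next_milestone e v0 p w = w.
  have := milestones_next_mem buw pMw; rewrite EM => /setUP[/(milestones_sep
    buv) sN|/set1P//].
  by have := subsetP sN E; rewrite (sepD p) EpN (negPf Eup) (negPf Euv) => /(_
    isT).
(* Since [w] succeeds [p], the milestone [v] is either not beyond [p], which forces [v = p], or
   beyond [w], which [E] forbids. *)
have [/subsetP svp|/subsetP/(_ E)] := milestones_chain buw pMw vMw; last first.
  by rewrite Npw sep_extend // in_setU EL orbT (negPf Euv) => /(_ isT).
case/eqP: npv; apply: (@sep_inj u); apply/eqP;
  rewrite eqEsubset milestones_sep //=.
exact/subsetP.
Qed.

End NonPOF.

End Extension.

End Basepoint.

End Median.

(** The side conditions exclude degenerate cases. If [L] is empty then [w = v], so (ii) is trivial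
    while (i) fails for [u != v]. If [u = v] the penultimate classes form the empty set, so (iii)
    fails for nonempty [L] while (ii) holds. *)
Theorem theorem8 (V : finType) (e : rel V) (v0 u v w : V)
    (L : {set {set {set V}}}) :
  median_graph e ->
  u \in interval e v0 v ->
  POF e L ->
  outgoing e v0 v L ->
  w = antibasis e v0 v L ->
  (L != set0 ->
     (penultimate e v0 u w = v <->
      milestones e v0 u w = milestones e v0 u v :|: [set w]))
  /\
  (u != v ->
     (milestones e v0 u w = milestones e v0 u v :|: [set w] <->
      forall E, E \in L -> ~~ POF e (penultimate_classes e v0 u v :|: [set E]))).
Proof.
move=> Gmed buv pL outL Ew; have oL := outgoing_incident Gmed pL outL.
have vw : sep e v w = L by rewrite Ew; apply: sep_antibasis => // E /oL[].
split=> [nL0|nuv]; first exact: penultimate_milestones vw nL0.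
rewrite (penultimate_classesE Gmed buv nuv).
by split=> [|H]; [apply: milestones_not_POF vw nuv | apply: milestones_extend vw nuv _].
Qed.
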